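(* Let $HE=\bigcup_{n=1}^{\infty}X_n\subset\mathbb{R}^2$ be the Hawaiian earring, where $X_n$ is the circle of radius $\frac1n$ centered at $(\frac1n,0)$, and let $p=(0,0)$. Let $L(HE,p)$ be the space of loops in $HE$ based at $p$ with the topology of uniform convergence, let $q:L(HE,p)\to\pi_1(HE,p)$ be the canonical surjection sending a loop to its path homotopy class, and give $\pi_1(HE,p)$ the quotient topology determined by $q$. Then: (1) the product map $q\times q: L(HE,p)\times L(HE,p)\to \pi_1(HE,p)\times\pi_1(HE,p)$ (with the product topologies on domain and codomain) is not a quotient map; (2) the standard multiplication $M:\pi_1(HE,p)\times\pi_1(HE,p)\to\pi_1(HE,p)$, given by concatenation of path classes, $M([f],[g])=[f]\ast[g]$, is discontinuous (where $\pi_1(HE,p)\times\pi_1(HE,p)$ carries the product topology); (3) the fundamental group $\pi_1(HE,p)$, with this quotient topology and the standard group operations, is not a topological group.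
   Context: $HE$ has the subspace topology from the Euclidean plane $\mathbb{R}^2$. $L(HE,p)$ denotes the set of continuous maps $f:[0,1]\to HE$ with $f(0)=f(1)=p$, with the topology of uniform convergence (equivalently, the compact-open topology). The map $q$ satisfies $q(f)=q(g)$ if and only if $f$ and $g$ are path homotopic in $HE$ (homotopic relative to endpoints). The quotient topology on $\pi_1(HE,p)$ is the one in which $A\subset\pi_1(HE,p)$ is closed if and only if $q^{-1}(A)$ is closed in $L(HE,p)$. A surjection $h:Y\to Z$ of topological spaces is a quotient map if a subset $A\subset Z$ is closed in $Z$ if and only if $h^{-1}(A)$ is closed in $Y$. *)

(* Defs.v *)
From HB Require Import structures.
From mathcomp Require Import all_boot all_order all_algebra generic_quotient.
From mathcomp Require Import all_classical all_reals all_analysis.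
From mathcomp Require Import homotopy lra.

Set Implicit Arguments.
Unset Strict Implicit.
Unset Printing Implicit Defensive.
Import Order.TTheory GRing.Theory Num.Theory.
Import numFieldNormedType.Exports.
Local Open Scope classical_set_scope.
Local Open Scope ring_scope.
Local Open Scope quotient_scope.

Definition quotient_map (Y Z : topologicalType) (h : Y -> Z) : Prop :=
  range h = [set: Z] /\ forall A : set Z, closed A <-> closed (h @^-1` A).

HB.structure Definition PreTopologicalGroup := {G of Topological G & Group G}.

Definition is_topological_group (G : PreTopologicalGroup.type) : Prop :=
  continuous (fun x : G * G => (x.1 * x.2)%g) /\
  continuous (fun x : G => (x^-1)%g).

Section unit_interval.
Variable R : realType.

Definition unit_interval : Type := set_type (`[0, 1]%classic : set R).

HB.instance Definition _ := Topological.on unit_interval.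

Lemma clampP (x : R) :
  Order.max 0 (Order.min x 1) \in (`[0, 1]%classic : set R).
Proof.
by rewrite inE /= in_itv /= le_max lexx /= ge_max ler01 /= ge_min lexx orbT.
Qed.

(* The retraction of the real line onto [0, 1]. In [concat] and [reverse] below
   it is only applied to numbers of [0, 1], where it is the identity: it serves
   to see them as elements of the subtype. *)
Definition clamp (x : R) : unit_interval :=
  exist (fun x => x \in (`[0, 1]%classic : set R)) _ (clampP x).

Arguments clamp : simpl never.

Lemma clampE x : 0 <= x <= 1 -> val (clamp x) = x.
Proof. by case/andP=> x0 x1; rewrite /= min_l // max_r. Qed.

Lemma unit_intervalP (t : unit_interval) : 0 <= val t <= 1.
Proof. by have := set_valP t; rewrite /= in_itv. Qed.

Lemma valK01 (t : unit_interval) : clamp (val t) = t.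
Proof. by apply: val_inj; rewrite clampE ?unit_intervalP. Qed.

Lemma zero_neq_one01 : clamp 0 != clamp 1.
Proof.
apply/eqP => /(congr1 val); rewrite !clampE ?lexx ?ler01 //.
by apply/eqP; rewrite eq_sym oner_eq0.
Qed.

HB.instance Definition _ := isBiPointed.Build unit_interval zero_neq_one01.

Lemma val01E : ((val (clamp 0) = 0) * (val (clamp 1) = 1)) *
  ((Order.max 0 (Order.min 0 1) = 0 :> R) *
   (Order.max 0 (Order.min 1 1) = 1 :> R)).
Proof. by rewrite !clampE ?lexx ?ler01 // (@min_l _ _ 0) ?ler01 // minxx maxxx max_r. Qed.

End unit_interval.


Section path_homotopy.
Context {R : realType} {X : topologicalType} {x y : X}.

Definition path_homotopic
    (f g : {path (unit_interval R) from x to y in X}) : Prop :=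
  exists H : unit_interval R * unit_interval R -> X,
    [/\ continuous H,
        forall s, H (s, zero) = f s,
        forall s, H (s, one) = g s,
        forall t, H (zero, t) = x
      & forall t, H (one, t) = y].

End path_homotopy.

Section gluing.
Context {R : realType} {T X : topologicalType}.

Lemma clamp_continuous (u : T -> R) :
  continuous u -> continuous (fun z => clamp (u z)).
Proof.
move=> cu; apply: continuous_comp_initial => z /=.
apply: (@continuous_max R _ (fun=> 0) (fun z => Order.min (u z) 1)).
  exact: cvg_cst.
apply: (@continuous_min R _ u (fun=> 1)); first exact: cu.
exact: cvg_cst.
Qed.

Lemma glue_continuous (u : T -> R) (c : R) (F G : T -> X) :
  continuous u -> continuous F -> continuous G ->
  (forall z, u z = c -> F z = G z) ->
  continuous (fun z => if u z <= c then F z else G z).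
Proof.
move=> cu cF cG FG; apply/continuous_subspace_setT.
have -> : [set: T] = [set z | u z <= c] `|` [set z | c <= u z].
  by apply/seteqP; split=> // z _ /=; case: (leP (u z) c) => [|/ltW]; [left|right].
apply: withinU_continuous.
- exact: (closed_comp (fun z _ => cu z) (@closed_le R c)).
- exact: (closed_comp (fun z _ => cu z) (@closed_ge R c)).
- apply: subspace_eq_continuous (continuous_subspaceT cF) => z.
  by rewrite inE /= /from_subspace => ->.
- apply: subspace_eq_continuous (continuous_subspaceT cG) => z.
  rewrite inE /= /from_subspace => cuz; case: ifPn => // uc.
  by apply/esym/FG/le_anti; rewrite uc cuz.
Qed.

End gluing.

Lemma continuous_comp2 (S T U : topologicalType) (u : S -> T) (h : T -> U) :
  continuous u -> continuous h -> continuous (fun z => h (u z)).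
Proof. by move=> cu ch z; apply: continuous_comp; [exact: cu|exact: ch]. Qed.

Section real_continuity.
Context {R : realType} {T : topologicalType}.
Implicit Types u v : T -> R.

Lemma cts_cst (c : R) : continuous (fun _ : T => c).
Proof. by move=> z; exact: cvg_cst. Qed.

Lemma cts_add u v : continuous u -> continuous v -> continuous (fun z => u z + v z).
Proof. by move=> cu cv z; apply: cvgD; [exact: cu|exact: cv]. Qed.

Lemma cts_opp u : continuous u -> continuous (fun z => - u z).
Proof. by move=> cu z; apply: cvgN; exact: cu. Qed.

Lemma cts_mul u v : continuous u -> continuous v -> continuous (fun z => u z * v z).
Proof. by move=> cu cv z; apply: cvgM; [exact: cu|exact: cv]. Qed.

Lemma cts_min u v : continuous u -> continuous v ->
  continuous (fun z => Order.min (u z) (v z)).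
Proof. by move=> cu cv z; exact: (@continuous_min R _ u v z (cu z) (cv z)). Qed.

Lemma cts_val (h : T -> unit_interval R) :
  continuous h -> continuous (fun z => val (h z) : R).
Proof.
by move=> ch; apply: (continuous_comp2 ch); exact: initial_continuous.
Qed.

End real_continuity.

Lemma cts_id (T : topologicalType) : continuous (fun z : T => z).
Proof. by move=> z; exact: cvg_id. Qed.

Lemma cts_fst (S T : topologicalType) : continuous (@fst S T).
Proof. by move=> z; exact: cvg_fst. Qed.

Lemma cts_snd (S T : topologicalType) : continuous (@snd S T).
Proof. by move=> z; exact: cvg_snd. Qed.

Lemma cts_pair (S T U : topologicalType) (u : S -> T) (v : S -> U) :
  continuous u -> continuous v -> continuous (fun z => (u z, v z)).
Proof. by move=> cu cv z; apply: cvg_pair; [exact: cu|exact: cv]. Qed.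

Ltac cts_tac := repeat first
  [ exact: cts_cst | exact: cts_id | exact: cts_fst | exact: cts_snd | exact: initial_continuous
  | apply: cts_add | apply: cts_opp | apply: cts_mul | apply: cts_min
  | apply: cts_pair | apply: cts_val | apply: clamp_continuous ].

Section path_operations.
Context {R : realType} {X : topologicalType}.
Local Notation I := (unit_interval R).

Section concatenation.
Context {x y z : X} (f : {path I from x to y in X}) (g : {path I from y to z in X}).

Definition concat_fun (t : I) : X :=
  if val t <= 2^-1 then f (clamp (2 * val t)) else g (clamp (2 * val t - 1)).

Lemma concat_continuous : continuous concat_fun.
Proof.
apply: glue_continuous.
- exact: initial_continuous.
- by apply: continuous_comp2 (@cts_fun _ _ f); apply: clamp_continuous; cts_tac.
- by apply: continuous_comp2 (@cts_fun _ _ g); apply: clamp_continuous; cts_tac.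
- move=> t ->; rewrite divff // subrr; exact: etrans path_one (esym path_zero).
Qed.

Lemma concat_zero : concat_fun zero = x.
Proof.
by rewrite /concat_fun val01E invr_ge0 ler0n mulr0 path_zero.
Qed.

Lemma concat_one : concat_fun one = z.
Proof.
rewrite /concat_fun val01E leNgt invf_lt1 // ltr1n /=.
by rewrite mulr1 -[2]/(1 + 1) addrK path_one.
Qed.

Definition concat : {path I from x to z in X} :=
  mk_path concat_continuous concat_zero concat_one.

Lemma concatE t : concat t =
  if val t <= 2^-1 then f (clamp (2 * val t)) else g (clamp (2 * val t - 1)).
Proof. by []. Qed.

End concatenation.

Section reversal.
Context {x y : X} (f : {path I from x to y in X}).

Definition reverse_fun (t : I) : X := f (clamp (1 - val t)).

Lemma reverse_continuous : continuous reverse_fun.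
Proof.
by apply: continuous_comp2 (@cts_fun _ _ f); apply: clamp_continuous; cts_tac.
Qed.

Lemma reverse_zero : reverse_fun zero = y.
Proof. by rewrite /reverse_fun val01E subr0 path_one. Qed.

Lemma reverse_one : reverse_fun one = x.
Proof. by rewrite /reverse_fun val01E subrr path_zero. Qed.

Definition reverse : {path I from y to x in X} :=
  mk_path reverse_continuous reverse_zero reverse_one.

Lemma reverseE t : reverse t = f (clamp (1 - val t)).
Proof. by []. Qed.

End reversal.

End path_operations.

Section homotopy_equivalence.
Context {R : realType} {X : topologicalType}.
Local Notation I := (unit_interval R).

Lemma path_homotopic_refl (x y : X) (f : {path I from x to y in X}) :
  path_homotopic f f.
Proof.
exists (fun st => f st.1); split=> //.
- by apply: continuous_comp2 (@cts_fun _ _ f); exact: cts_fst.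
- by move=> t; rewrite path_zero.
- by move=> t; rewrite path_one.
Qed.

Lemma path_homotopic_sym (x y : X) (f g : {path I from x to y in X}) :
  path_homotopic f g -> path_homotopic g f.
Proof.
move=> [H [cH Hf Hg Hx Hy]]; exists (fun st => H (st.1, clamp (1 - val st.2))).
split=> [|s|s|t|t] //=.
- by apply: continuous_comp2 cH; cts_tac.
- by rewrite val01E subr0 Hg.
- by rewrite val01E subrr Hf.
Qed.

Lemma path_homotopic_trans (x y : X) (f g h : {path I from x to y in X}) :
  path_homotopic f g -> path_homotopic g h -> path_homotopic f h.
Proof.
move=> [H [cH Hf Hg Hx Hy]] [K [cK Kg Kh Kx Ky]].
exists (fun st => if val st.2 <= 2^-1 then H (st.1, clamp (2 * val st.2))
                  else K (st.1, clamp (2 * val st.2 - 1))).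
split=> [|s|s|t|t] /=.
- apply: glue_continuous.
  + by cts_tac.
  + by apply: continuous_comp2 cH; cts_tac.
  + by apply: continuous_comp2 cK; cts_tac.
  + move=> st ->; rewrite divff // subrr; exact: etrans (Hg _) (esym (Kg _)).
- by rewrite val01E invr_ge0 ler0n mulr0 Hf.
- rewrite val01E leNgt invf_lt1 // ltr1n /=.
  by rewrite mulr1 -[2]/(1 + 1) addrK Kh.
- by case: ifP.
- by case: ifP.
Qed.

Lemma concat_homotopic (x y z : X)
    (f f' : {path I from x to y in X}) (g g' : {path I from y to z in X}) :
  path_homotopic f f' -> path_homotopic g g' ->
  path_homotopic (concat f g) (concat f' g').
Proof.
move=> [H [cH Hf Hg Hx Hy]] [K [cK Kf Kg Kx Ky]].
exists (fun st => if val st.1 <= 2^-1 then H (clamp (2 * val st.1), st.2)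
                  else K (clamp (2 * val st.1 - 1), st.2)).
split=> [|s|s|t|t] /=.
- apply: glue_continuous.
  + by cts_tac.
  + by apply: continuous_comp2 cH; cts_tac.
  + by apply: continuous_comp2 cK; cts_tac.
  + move=> st ->; rewrite divff // subrr; exact: etrans (Hy _) (esym (Kx _)).
- by rewrite concatE Hf Kf.
- by rewrite concatE Hg Kg.
- by rewrite val01E invr_ge0 ler0n mulr0 Hx.
- rewrite val01E leNgt invf_lt1 // ltr1n /=.
  by rewrite mulr1 -[2]/(1 + 1) addrK Ky.
Qed.

Lemma reverse_homotopic (x y : X) (f f' : {path I from x to y in X}) :
  path_homotopic f f' -> path_homotopic (reverse f) (reverse f').
Proof.
move=> [H [cH Hf Hg Hx Hy]]; exists (fun st => H (clamp (1 - val st.1), st.2)).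
split=> [|s|s|t|t] /=.
- by apply: continuous_comp2 cH; cts_tac.
- by rewrite Hf.
- by rewrite Hg.
- by rewrite val01E subr0; exact: Hy.
- by rewrite val01E subrr; exact: Hx.
Qed.

Lemma reparam_homotopic (a b x y : X) (f : {path I from a to b in X}) (u v : R -> R)
    (g h : {path I from x to y in X}) :
  continuous u -> continuous v -> u 0 = v 0 -> u 1 = v 1 ->
  (forall t : I, g t = f (clamp (u (val t)))) ->
  (forall t : I, h t = f (clamp (v (val t)))) ->
  path_homotopic g h.
Proof.
move=> cu cv uv0 uv1 gE hE.
exists (fun st => f (clamp ((1 - val st.2) * u (val st.1)
                            + val st.2 * v (val st.1)))).
split=> [|s|s|t|t] /=.
- apply: continuous_comp2 (@cts_fun _ _ f); cts_tac.
    by apply: continuous_comp2 cu; cts_tac.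
  by apply: continuous_comp2 cv; cts_tac.
- by rewrite val01E subr0 mul1r mul0r addr0 gE.
- by rewrite val01E subrr mul1r mul0r add0r hE.
- rewrite val01E -uv0 -mulrDl subrK mul1r.
  have -> : u 0 = u (val (zero : I)) by rewrite val01E.
  by rewrite -gE path_zero.
- rewrite val01E -uv1 -mulrDl subrK mul1r.
  have -> : u 1 = u (val (one : I)) by rewrite val01E.
  by rewrite -gE path_one.
Qed.

Lemma concat_cst_l (x y : X) (f : {path I from x to y in X}) :
  path_homotopic (concat (cst x : {path I from x to x in X}) f) f.
Proof.
apply: (@reparam_homotopic _ _ _ _ f (fun s => - Order.min 0 (1 - 2 * s)) id).
- by cts_tac.
- by move=> z; exact: cvg_id.
- by rewrite mulr0 subr0 min_l ?ler01// oppr0.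
- by rewrite mulr1 min_r ?opprB; lra.
- move=> t; cbv beta; rewrite concatE; case: ifPn => [t2|t2].
    by rewrite min_l ?oppr0; [exact/esym/path_zero|lra].
  by rewrite min_r ?opprB//; lra.
- by move=> t; rewrite valK01.
Qed.

Lemma concat_cst_r (x y : X) (f : {path I from x to y in X}) :
  path_homotopic (concat f (cst y : {path I from y to y in X})) f.
Proof.
apply: (@reparam_homotopic _ _ _ _ f (fun s => Order.min (2 * s) 1) id).
- by cts_tac.
- by move=> z; exact: cvg_id.
- by rewrite mulr0 min_l ?ler01.
- by rewrite mulr1 min_r //; lra.
- move=> t; cbv beta; rewrite concatE; case: ifPn => [t2|t2].
    by rewrite min_l //; lra.
  by rewrite min_r; [exact/esym/path_one|lra].
- by move=> t; rewrite valK01.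
Qed.

Lemma concat_reverse_r (x y : X) (f : {path I from x to y in X}) :
  path_homotopic (concat f (reverse f)) (cst x : {path I from x to x in X}).
Proof.
apply: (@reparam_homotopic _ _ _ _ f
  (fun s => Order.min (2 * s) (2 - 2 * s)) (fun=> 0)).
- by cts_tac.
- by cts_tac.
- by rewrite min_l; lra.
- by rewrite min_r; lra.
- move=> t; have /andP[t0 t1] := unit_intervalP t.
  cbv beta; rewrite concatE; case: ifPn => [t2|t2].
    by rewrite min_l //; lra.
  rewrite min_r; last by lra.
  apply: etrans (reverseE f _) _; rewrite clampE; last by lra.
  by congr (f (clamp _)); lra.
- by move=> t; exact/esym/path_zero.
Qed.

Lemma concat_reverse_l (x y : X) (f : {path I from x to y in X}) :
  path_homotopic (concat (reverse f) f) (cst y : {path I from y to y in X}).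
Proof.
apply: (@reparam_homotopic _ _ _ _ f
  (fun s => 1 - Order.min (2 * s) (2 - 2 * s)) (fun=> 1)).
- by cts_tac.
- by cts_tac.
- by rewrite min_l; lra.
- by rewrite min_r; lra.
- move=> t; have /andP[t0 t1] := unit_intervalP t.
  cbv beta; rewrite concatE; case: ifPn => [t2|t2].
    rewrite min_l; last by lra.
    by apply: etrans (reverseE f _) _; rewrite clampE //; lra.
  by rewrite min_r; [congr (f (clamp _)); lra|lra].
- by move=> t; exact/esym/path_one.
Qed.

Lemma concatA_homotopic (x y z w : X) (f : {path I from x to y in X})
    (g : {path I from y to z in X}) (h : {path I from z to w in X}) :
  path_homotopic (concat f (concat g h)) (concat (concat f g) h).
Proof.
apply: (@reparam_homotopic _ _ _ _ (concat f (concat g h)) id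
  (fun s => Order.min (2 * s) (Order.min (s + 4^-1) (s / 2 + 2^-1)))).
- by move=> t; exact: cvg_id.
- by cts_tac.
- by rewrite mulr0 add0r mul0r add0r (@min_l _ _ 4^-1) ?min_l; lra.
- by rewrite (@min_r _ _ (_ + _)) ?min_r; lra.
- by move=> t; rewrite valK01.
- move=> t; have /andP[t0 t1] := unit_intervalP t.
  cbv beta; rewrite [LHS]concatE; case: ifPn => t2.
    rewrite (@min_l _ _ (_ + _)); last by lra.
    apply: etrans (concatE f g _) _; rewrite clampE; last by lra.
    case: ifPn => t4.
      rewrite min_l; last by lra.
      by rewrite [RHS]concatE clampE ?ifT//; lra.
    rewrite min_r; last by lra.
    rewrite [RHS]concatE clampE; last by lra.
    rewrite ifF; last by apply/negbTE; lra.
    apply: etrans _ (esym (concatE g h _)); rewrite clampE; last by lra.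
    by rewrite ifT; [congr (g (clamp _)); lra|lra].
  rewrite (@min_r _ _ (_ + _)); last by lra.
  rewrite min_r; last by lra.
  rewrite [RHS]concatE clampE; last by lra.
  rewrite ifF; last by apply/negbTE; lra.
  apply: etrans _ (esym (concatE g h _)); rewrite clampE; last by lra.
  by rewrite ifF; [congr (h (clamp _)); lra|apply/negbTE; lra].
Qed.

End homotopy_equivalence.

Section fundamental_group.
Context (R : realType) (X : uniformType) (p : X).
Local Notation I := (unit_interval R).

(* The library equips path types with the compact-open topology; loop spaces
   are given the topology of uniform convergence on [0, 1] instead. *)
Definition loop_space : Type := {path I from p to p in X}.

HB.instance Definition _ := Choice.on loop_space.
HB.instance Definition _ := Topological.copy loop_space
  (initial_topology (fun f : loop_space => (f : {uniform I -> X}))).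

Definition loop_homotopic (f g : loop_space) : bool := `[< path_homotopic f g >].

Lemma loop_homotopic_equiv : equiv_class_of loop_homotopic.
Proof.
split=> [f|f g|g f h].
- exact/asboolP/path_homotopic_refl.
- by apply/asboolP/asboolP; exact: path_homotopic_sym.
- by move=> /asboolP fg /asboolP gh; apply/asboolP/(path_homotopic_trans fg).
Qed.

Canonical loop_homotopic_equivRel := EquivRelPack loop_homotopic_equiv.

Definition pi1 : Type := {eq_quot loop_homotopic_equivRel}.

HB.instance Definition _ := Quotient.on pi1.
HB.instance Definition _ := Topological.copy pi1 (quotient_topology pi1).

Definition loop_class (f : loop_space) : pi1 := \pi_pi1 f.

Lemma loop_class_eq (f g : loop_space) :
  loop_class f = loop_class g <-> path_homotopic f g.
Proof.
split=> [/eqmodP/asboolP//|fg]; exact/eqmodP/asboolP.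
Qed.

Lemma pi1_closedP (A : set pi1) : closed A <-> closed (loop_class @^-1` A).
Proof.
split=> [|cA]; first by move/closed_comp; apply=> f _; exact: pi_continuous.
by rewrite -openC; rewrite -openC in cA.
Qed.

Definition pi1_one : pi1 := loop_class (cst p : {path I from p to p in X}).

Definition pi1_mul (a b : pi1) : pi1 := loop_class (concat (repr a) (repr b)).

Definition pi1_inv (a : pi1) : pi1 := loop_class (reverse (repr a)).

Lemma repr_homotopic (f : loop_space) : path_homotopic (repr (loop_class f)) f.
Proof. by apply/loop_class_eq; rewrite /loop_class reprK. Qed.

Lemma pi1_mulE (f g : loop_space) :
  pi1_mul (loop_class f) (loop_class g) = loop_class (concat f g).
Proof. by apply/loop_class_eq/concat_homotopic; exact: repr_homotopic. Qed.

Lemma pi1_invE (f : loop_space) :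
  pi1_inv (loop_class f) = loop_class (reverse f).
Proof. by apply/loop_class_eq/reverse_homotopic; exact: repr_homotopic. Qed.

Lemma pi1_ind (P : pi1 -> Prop) : (forall f, P (loop_class f)) -> forall a, P a.
Proof. by move=> Pf a; rewrite -[a]reprK; exact: Pf. Qed.

Lemma pi1_mulA : associative pi1_mul.
Proof.
elim/pi1_ind=> f; elim/pi1_ind=> g; elim/pi1_ind=> h; rewrite !pi1_mulE.
exact/loop_class_eq/concatA_homotopic.
Qed.

Lemma pi1_mul1 : left_id pi1_one pi1_mul.
Proof.
elim/pi1_ind=> f; rewrite pi1_mulE; exact/loop_class_eq/concat_cst_l.
Qed.

Lemma pi1_mulr1 : right_id pi1_one pi1_mul.
Proof.
elim/pi1_ind=> f; rewrite pi1_mulE; exact/loop_class_eq/concat_cst_r.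
Qed.

Lemma pi1_mulV : left_inverse pi1_one pi1_inv pi1_mul.
Proof.
elim/pi1_ind=> f; rewrite pi1_invE pi1_mulE.
exact/loop_class_eq/concat_reverse_l.
Qed.

Lemma pi1_mulrV : right_inverse pi1_one pi1_inv pi1_mul.
Proof.
elim/pi1_ind=> f; rewrite pi1_invE pi1_mulE.
exact/loop_class_eq/concat_reverse_r.
Qed.

HB.instance Definition _ :=
  isGroup.Build pi1 pi1_mulA pi1_mul1 pi1_mulr1 pi1_mulV pi1_mulrV.

End fundamental_group.

Section hawaiian_earring.
Context (R : realType).

Definition circle (c : R * R) (r : R) : set (R * R) :=
  [set z | Num.sqrt ((z.1 - c.1) ^+ 2 + (z.2 - c.2) ^+ 2) = r].

Definition hawaiian_earring : set (R * R) :=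
  \bigcup_(n in [set n : nat | (1 <= n)%N]) circle (n%:R^-1, 0) n%:R^-1.

(* The uniformity on [R * R] is the product one; it is induced by the sup norm,
   hence also by the Euclidean norm. *)
Definition HE : uniformType := set_type hawaiian_earring.

Lemma origin_in_HE : (0, 0) \in hawaiian_earring.
Proof.
rewrite inE; exists 1%N => //=.
by rewrite /circle /= invr1 sub0r subrr sqrrN expr1n expr0n addr0 sqrtr1.
Qed.

Definition HE_base : HE :=
  exist (fun z => z \in hawaiian_earring) (0, 0) origin_in_HE.

End hawaiian_earring.

(* Main.v *)
Require Import Defs.
From mathcomp Require Import all_boot all_order all_algebra generic_quotient.
From mathcomp Require Import all_classical all_reals all_analysis.
From mathcomp Require Import homotopy lra zify ring.

(** Write [x_k] for the loop that runs once around the circle [X_k].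

    For [i <> j], let [x_i] act on the integers by [s : z |-> - z], [x_j] by
    [t : z |-> 1 - z], and all other circles trivially.  This is an action of
    the fundamental group through the infinite dihedral group, in which
    [(s t)^m] is a translation by [m].  It is obtained here without covering
    spaces: sample a loop finely, and apply [s], resp. [t], whenever two
    successive samples lie on the two sides of the point of [X_i], resp.
    [X_j], antipodal to the origin.  As [s] and [t] are involutions, the
    direction of a crossing is irrelevant.  The resulting map [holonomy i j f]
    is the same for all fine samplings and for uniformly close loops
    ([holonomy_close]), hence it is locally constant on the loop space, and,
    by cutting a homotopy into a fine grid, it is invariant under homotopy
    ([holonomy_homotopic]).

    The image of [0] under a product of [s]'s and [t]'s can only be large if
    [s] and [t] alternate often.  As long as a loop stays close to the far half
    of [X_i] only [s] occurs, and leaving this half and coming back takes a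
    displacement that is bounded below in terms of [i] alone.  So, near a given
    loop, the image of [0] under [holonomy i j] stays in a window that depends
    on [i] but not on [j] ([holonomy_window]).

    Call a loop [oscillating] if for some [0 < n < k] the holonomy for
    [(X_1, X_{k+1})] moves [0] outside the [n]-th window and the one for
    [(X_{n+1}, X_{k+1})] moves [0] outside the [k]-th window.  Near a given
    loop, the window for [X_1] bounds [n], and then the windows for the
    remaining [X_{n+1}] bound [k]; so only finitely many pairs matter, and the
    classes of oscillating loops form a closed set [A] of the fundamental
    group ([closed_oscillating_classes]).

    Now consider [a(n, k) = (x_{n+1} x_{k+1})^(2 (k + 2))] and
    [w(n, k) = (x_1 x_{k+1} x_1^-1 x_{k+1})^(n + 2)].  The product
    [a(n, k) w(n, k)] is oscillating ([oscillating_witness]).  The loops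
    [a(n, k)] tend to the constant loop as [n] and [k] grow; for fixed [n] the
    loops [w(n, k)] tend, as [k] grows, to a power of [x_1 x_1^-1], which is
    null-homotopic.  Hence a neighbourhood of the pair [(1, 1)] always contains
    a pair of classes whose product lies in [A], whereas [1] does not lie in
    [A]: the inverse image [B] of [A] under multiplication is not closed
    ([not_closed_oscillating_products]).  This is the discontinuity of
    multiplication.  But concatenation of loops is continuous, so the inverse
    image of [B] in the square of the loop space is closed, and the square of
    the quotient map is not a quotient map. *)

Set Implicit Arguments.
Unset Strict Implicit.
Unset Printing Implicit Defensive.
Import Order.TTheory GRing.Theory Num.Theory.
Import numFieldNormedType.Exports.
Local Open Scope classical_set_scope.
Local Open Scope ring_scope.

(** * The circles near their antipodal points *)

Section geometry.
Context {R : realType}.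
Implicit Types (u v w : R * R) (k : nat) (e : R).

Definition close e u v : Prop := `|u.1 - v.1| < e /\ `|u.2 - v.2| < e.

Lemma close_sym e u v : close e u v -> close e v u.
Proof. by rewrite /close (distrC u.1) (distrC u.2). Qed.

Lemma close_trans e1 e2 u v w :
  close e1 u v -> close e2 v w -> close (e1 + e2) u w.
Proof.
move=> [uv1 uv2] [vw1 vw2]; split.
  by apply: le_lt_trans (ler_distD v.1 _ _) _; exact: ltrD.
by apply: le_lt_trans (ler_distD v.2 _ _) _; exact: ltrD.
Qed.

Lemma close_le e1 e2 u v : e1 <= e2 -> close e1 u v -> close e2 u v.
Proof. by move=> e12 [uv1 uv2]; split; apply: lt_le_trans e12. Qed.

Lemma close_refl e u : 0 < e -> close e u u.
Proof. by move=> e0; split; rewrite subrr normr0. Qed.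

(** The equation of [X_k] without square roots or denominators. *)
Definition on_circle k u : bool :=
  k%:R * (u.1 ^+ 2 + u.2 ^+ 2) == 2 * u.1.

Lemma circleP k u : (0 < k)%N ->
  circle (k%:R^-1, 0) k%:R^-1 u <-> on_circle k u.
Proof.
move=> k0; have K0 : 0 < k%:R :> R by rewrite ltr0n.
rewrite /circle /on_circle /= subr0.
have E : (u.1 - k%:R^-1) ^+ 2 + u.2 ^+ 2 - k%:R^-1 ^+ 2 =
  k%:R^-1 * (k%:R * (u.1 ^+ 2 + u.2 ^+ 2) - 2 * u.1).
  by field; rewrite gt_eqF.
split=> [H|/eqP H].
  rewrite -subr_eq0; have /eqP : k%:R^-1 * (k%:R * (u.1 ^+ 2 + u.2 ^+ 2) - 2 * u.1) = 0.
    by rewrite -E -[k%:R^-1 ^+ 2](congr1 (fun r => r ^+ 2) H) sqr_sqrtr ?subrr // addr_ge0 ?sqr_ge0.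
  by rewrite mulf_eq0 invr_eq0 gt_eqF.
move: E; rewrite H subrr mulr0 => /eqP; rewrite subr_eq0 => /eqP ->.
by rewrite sqrtr_sqr ger0_norm // invr_ge0 ltW.
Qed.

Lemma mem_earring u :
  hawaiian_earring u <-> exists2 k, (0 < k)%N & on_circle k u.
Proof.
split=> [[k /= k0 /(circleP _ k0)]|[k k0 /(circleP _ k0)]]; by exists k.
Qed.

(** The half of [X_k] away from the origin, where the other circles are at a
    positive distance from [X_k]. *)
Definition far k u : bool := on_circle k u && (1 < k%:R * u.1).

Definition side u : bool := u.2 < 0.

Definition crossing k u v : bool :=
  [&& far k u, far k v & side u != side v].

(** A distance so small that the far half of [X_k] is isolated from the other
    circles, and that a jump across the antipodal point of [X_k] starts and
    ends near that point. *)
Definition mesh k : R := (32 * k%:R ^+ 3)^-1.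

Lemma mesh_gt0 k : (0 < k)%N -> 0 < mesh k.
Proof. by move=> k0; rewrite invr_gt0 mulr_gt0 // exprn_gt0 // ltr0n. Qed.

Lemma far_circle_unique k m u : far k u -> on_circle m u -> k = m.
Proof.
move=> /andP[/eqP ku ku1] /eqP mu.
have : (k%:R - m%:R) * (u.1 ^+ 2 + u.2 ^+ 2) = 0 by rewrite mulrBl ku mu subrr.
move/eqP; rewrite mulf_eq0 => /orP[|/eqP u0]; last first.
  by exfalso; move: ku ku1; rewrite u0 mulr0; nra.
by rewrite subr_eq0 eqr_nat => /eqP.
Qed.

(** If [w] lies on [X_m] with [m <> k], then [k |w|^2 - 2 w_1] is the nonzero
    integer [k - m] times [|w|^2]; but this function vanishes at [u], so it is
    small at [w], which would force [w] to be near the origin. *)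
Lemma far_close_circle k u w : (0 < k)%N ->
  far k u -> hawaiian_earring w -> close (mesh k) u w -> on_circle k w.
Proof.
move=> k0 /andP[/eqP ku ku1] /mem_earring[m m0 mw] uw.
have [->//|km] := eqVneq k m.
have K1 : 1 <= k%:R :> R by rewrite ler1n.
have M1 : 1 <= m%:R :> R by rewrite ler1n.
have KM : 1 <= (k%:R - m%:R : R) ^+ 2.
  have /orP[/subnKC <-|/subnKC <-] : ((k < m) || (m < k))%N by rewrite -neq_ltn.
    by rewrite -addn1 !natrD; have : 0 <= (m - (k + 1))%:R :> R by []; nra.
  by rewrite -addn1 !natrD; have : 0 <= (k - (m + 1))%:R :> R by []; nra.
case: uw => uw1 uw2.
set K : R := k%:R in ku ku1 K1 KM uw1 uw2 *; set M : R := m%:R in M1 KM mw.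
set d := mesh k in uw1 uw2.
have dK : 32 * K ^+ 3 * d = 1.
  by rewrite /d /mesh -/K divff // gt_eqF // mulr_gt0 // exprn_gt0 //; lra.
have d0 : 0 < d by exact: mesh_gt0.
move: uw1 uw2; rewrite !ltr_norml => /andP[a1 a2] /andP[b1 b2].
move/eqP: mw => mw.
case: u ku ku1 a1 a2 b1 b2 => x y /= ku ku1 a1 a2 b1 b2.
case: w mw a1 a2 b1 b2 => x' y' /= mw a1 a2 b1 b2.
have K3 : K <= K ^+ 3 by rewrite -[leLHS]expr1 ler_weXn2l.
have K0 : 0 < K by lra.
have dK1 : 32 * (K * d) <= 1 by rewrite -[leRHS]dK -mulrA ler_pM2l // ler_pM2r.
have dKd : d <= K * d by rewrite ler_peMl // ltW.
have d1 : 32 * d <= 1 by lra.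
have x0 : 0 < x by rewrite -(pmulr_rgt0 _ K0); lra.
have x2 : x <= 2.
  have : x ^+ 2 <= K * (x ^+ 2 + y ^+ 2).
    apply: (@le_trans _ _ (x ^+ 2 + y ^+ 2)); first by rewrite lerDl sqr_ge0.
    by rewrite ler_peMl // addr_ge0 ?sqr_ge0.
  by rewrite ku expr2 ler_pM2r.
have y1 : y ^+ 2 <= 1.
  have : x ^+ 2 + y ^+ 2 <= K * (x ^+ 2 + y ^+ 2).
    by rewrite ler_peMl // addr_ge0 ?sqr_ge0.
  by rewrite ku; have := sqr_ge0 (x - 1); nra.
have y2 : -1 <= y <= 1 by rewrite -ler_norml -(@ler_sqr R) ?nnegrE // expr1n real_normK ?num_real.
(* |K |w|^2 - 2 w_1| is small because the same expression vanishes at u. *)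
have /andP[c1 c2] : - (10 * K * d) <= K * (x' ^+ 2 + y' ^+ 2) - 2 * x' <= 10 * K * d.
  have -> : K * (x' ^+ 2 + y' ^+ 2) - 2 * x' =
    K * ((x' - x) * (x' + x) + (y' - y) * (y' + y)) - 2 * (x' - x).
    by rewrite -[LHS]subr0 -[X in _ - X](subrr (2 * x)) -{1}ku; ring.
  have e1 : - (5 * d) <= (x' - x) * (x' + x) <= 5 * d.
    by rewrite -ler_norml normrM mulrC ler_pM // ler_norml; lra.
  have e2 : - (3 * d) <= (y' - y) * (y' + y) <= 3 * d.
    case/andP: y2 => y2 y2'.
    by rewrite -ler_norml normrM mulrC ler_pM // ler_norml; lra.
  case/andP: e1 => e1 e1'; case/andP: e2 => e2 e2'.
  have f1 : K * (- (5 * d) - 3 * d) <= K * ((x' - x) * (x' + x) + (y' - y) * (y' + y)).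
    by rewrite ler_wpM2l; lra.
  have f2 : K * ((x' - x) * (x' + x) + (y' - y) * (y' + y)) <= K * (5 * d + 3 * d).
    by rewrite ler_wpM2l; lra.
  by apply/andP; split; lra.
exfalso.
have r0 : 0 <= x' ^+ 2 + y' ^+ 2 by rewrite addr_ge0 ?sqr_ge0.
have B0 : 0 <= 10 * K * d by rewrite !mulr_ge0 // ltW.
(* |w|^2 is at most |(K - M) |w|^2|, as K and M are distinct integers. *)
have r1 : x' ^+ 2 + y' ^+ 2 <= 10 * K * d.
  rewrite -(@ler_sqr R) ?nnegrE //.
  apply: (@le_trans _ _ ((K * (x' ^+ 2 + y' ^+ 2) - 2 * x') ^+ 2)); last first.
    by rewrite -(real_normK (num_real (_ - _))) ler_sqr ?nnegrE // ler_norml c1.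
  by rewrite -mw -mulrBl exprMn ler_peMl // sqr_ge0.
have r2 : K ^+ 2 * (x' ^+ 2 + y' ^+ 2) <= K ^+ 2 * (10 * K * d).
  by rewrite ler_pM2l // exprn_gt0; lra.
have g : 31 / 32 <= K * x'.
  have : K * (x - d) <= K * x' by rewrite ler_pM2l //; lra.
  by rewrite mulrBr; lra.
have g2 : K ^+ 2 * x' ^+ 2 >= (31 / 32) ^+ 2 by rewrite -exprMn ler_sqr ?nnegrE //; lra.
have g3 : 0 <= K ^+ 2 * y' ^+ 2 by rewrite -exprMn sqr_ge0.
have E3 : K ^+ 3 = K * K ^+ 2 by rewrite exprS.
rewrite E3 in dK.
have : K ^+ 2 * (10 * K * d) = 10 / 32 * (32 * (K * K ^+ 2) * d) by field.
by rewrite dK; move: r2 g2 g3; rewrite mulrDr; lra.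
Qed.

Lemma natr_mesh k : (0 < k)%N -> 32 * (k%:R * mesh k) <= 1.
Proof.
move=> k0; have K1 : 1 <= k%:R :> R by rewrite ler1n.
rewrite /mesh mulrA ler_pdivrMr ?mul1r ?mulr_gt0 ?exprn_gt0 ?ltr0n //.
by rewrite ler_pM2l // -[leLHS]expr1 ler_weXn2l.
Qed.

(** On [X_k] one has [(2 - k u_1) (k u_1) = k^2 u_2^2], so a point of the far
    half whose ordinate is below the mesh, as are the ends of a short jump
    between the two sides, has [k u_1] close to [2]. *)
Lemma crossing_far k u v w : (0 < k)%N -> hawaiian_earring w ->
  crossing k u v -> close (mesh k) u v -> close (mesh k) u w -> far k w.
Proof.
move=> k0 Hw /and3P[fu _ suv] [_ uv2] uw.
rewrite /far (far_close_circle k0 fu Hw uw) /=.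
case/andP: fu => /eqP ku ku1; case: uw => uw1 _.
have u2 : u.2 ^+ 2 <= mesh k ^+ 2.
  rewrite -(real_normK (num_real u.2)) ler_sqr ?nnegrE // ?ltW ?mesh_gt0 //.
  move: suv uv2; rewrite /side ltr_norml => suv /andP[].
  rewrite ltr_norml; case: (ltP u.2 0) suv => [u0|u0]; case: (ltP v.2 0) => // v0 _.
    by move=> *; apply/andP; split; lra.
  by move=> *; apply/andP; split; lra.
have := natr_mesh k0; set d := mesh k in u2 uw1 *.
have d0 : 0 < d by exact: mesh_gt0.
have K1 : 1 <= k%:R :> R by rewrite ler1n.
set K : R := k%:R in ku ku1 K1 * => Kd.
have H1 : K ^+ 2 * u.2 ^+ 2 <= (32^-1) ^+ 2.
  apply: (@le_trans _ _ ((K * d) ^+ 2)); first by rewrite exprMn ler_wpM2l // sqr_ge0.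
  have Kd0 : 0 <= K * d by rewrite mulr_ge0 // ltW.
  by rewrite ler_sqr ?nnegrE //; lra.
have H2 : (2 - K * u.1) * (K * u.1) = K ^+ 2 * u.2 ^+ 2.
  rewrite mulrBl [2 * _]mulrCA -ku; ring.
have H3 : K * u.1 >= 2 - (32^-1) ^+ 2.
  move: H1 ku1; rewrite -H2; set t := K * u.1; nra.
move: uw1; rewrite ltr_norml => /andP[_ uw1].
have : K * (u.1 - d) <= K * w.1 by rewrite ler_pM2l; lra.
by rewrite mulrBr; lra.
Qed.

Lemma crossing_sym k u v : crossing k u v = crossing k v u.
Proof. by rewrite /crossing andbCA eq_sym. Qed.

(** As soon as one edge of a small triangle is a crossing, its three vertices
    are far, and then the sides of the vertices decide on all three edges. *)
Lemma crossing_add k u v w : (0 < k)%N ->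
  hawaiian_earring u -> hawaiian_earring v -> hawaiian_earring w ->
  close (mesh k) u v -> close (mesh k) v w -> close (mesh k) u w ->
  crossing k u w = crossing k u v (+) crossing k v w.
Proof.
move=> k0 Hu Hv Hw uv vw uw.
have allfar : crossing k u v || crossing k v w || crossing k u w ->
    [&& far k u, far k v & far k w].
  case/orP => [/orP[]|] c; have /and3P[f1 f2 _] := c; rewrite f1 f2 /= ?andbT.
  - exact: crossing_far c uv uw.
  - rewrite crossing_sym in c; have := crossing_far k0 Hu c (close_sym vw) (close_sym uw).
    by rewrite crossing_sym in c => ->.
  - exact: crossing_far c uw uv.
have [/allfar /and3P[fu fv fw]|] := boolP (crossing k u v || crossing k v w || crossing k u w).
  by rewrite /crossing fu fv fw /=; case: (side u) (side v) (side w) => [] [] [].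
by rewrite !negb_or => /andP[/andP[/negbTE-> /negbTE->] /negbTE->].
Qed.

Lemma crossing_refl k u : crossing k u u = false.
Proof. by rewrite /crossing eqxx !andbF. Qed.

(** A point close to a crossing of [X_i] is far on [X_i], hence on no other
    circle. *)
Lemma crossing_disjoint i j u v w x : (0 < i)%N -> i != j ->
  hawaiian_earring w -> close (mesh i) u v -> close (mesh i) u w ->
  crossing i u v -> crossing j w x = false.
Proof.
move=> i0 ij Hw uv uw c; apply: contraNF ij => /and3P[/andP[wj _] _ _]; apply/eqP.
exact: far_circle_unique (crossing_far i0 Hw c uv uw) wj.
Qed.

End geometry.

(** * The dihedral action along a sequence of samples *)

Section walk.
Context {R : realType}.
Implicit Types (a b c : HE R) (z : int) (s : nat -> HE R).

Lemma HE_val a : hawaiian_earring (val a).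
Proof. exact: set_valP. Qed.

Definition step i j a b z : int :=
  if crossing i (val a) (val b) then - z
  else if crossing j (val a) (val b) then 1 - z else z.

Definition tight i j (e : R) : Prop := [/\ 0 < e, e <= mesh i & e <= mesh j].

Lemma tight_exists i j : (0 < i)%N -> (0 < j)%N -> exists e, tight i j e.
Proof.
move=> i0 j0; exists (Order.min (mesh i) (mesh j)).
by split; rewrite ?lt_min ?mesh_gt0 // ge_min lexx ?orbT.
Qed.

Lemma step_refl i j a z : step i j a a z = z.
Proof. by rewrite /step !crossing_refl. Qed.

(** The cocycle identity.  Within a small triangle only one of the two circles
    can be crossed, and the number of its crossed edges is even. *)
Lemma step_comp i j e a b c z : (0 < i)%N -> (0 < j)%N -> i != j -> tight i j e ->
  close e (val a) (val b) -> close e (val b) (val c) -> close e (val a) (val c) ->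
  step i j b c (step i j a b z) = step i j a c z.
Proof.
move=> i0 j0 ij [_ ei ej] ab bc ac.
have [abi bci aci] := And3 (close_le ei ab) (close_le ei bc) (close_le ei ac).
have [abj bcj acj] := And3 (close_le ej ab) (close_le ej bc) (close_le ej ac).
have addi := crossing_add i0 (HE_val a) (HE_val b) (HE_val c) abi bci aci.
have addj := crossing_add j0 (HE_val a) (HE_val b) (HE_val c) abj bcj acj.
have aa := close_refl (val a) (mesh_gt0 i0).
have bb := close_refl (val b) (mesh_gt0 i0).
have dis_ab : crossing i (val a) (val b) ->
    crossing j (val a) (val b) = false /\ crossing j (val b) (val c) = false.
  by move=> cr; split; apply: crossing_disjoint cr => //; exact: HE_val.
have dis_bc : crossing i (val b) (val c) ->
    crossing j (val a) (val b) = false /\ crossing j (val b) (val c) = false.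
  move=> cr; rewrite (crossing_sym _ (val a)).
  by split; apply: crossing_disjoint cr => //; exact: HE_val.
rewrite /step addi addj.
case: (crossing i (val a) (val b)) dis_ab => [/(_ isT)[-> ->]|_];
  case: (crossing i (val b) (val c)) dis_bc => [/(_ isT)[Eab Ebc]|_] //=.
- by rewrite opprK.
- by rewrite Eab.
by case: (crossing j _ _); case: (crossing j _ _) => //=; rewrite subKr.
Qed.

Fixpoint walk i j s n z : int :=
  if n is n'.+1 then step i j (s n') (s n) (walk i j s n' z) else z.

Lemma walkS i j s n z : walk i j s n.+1 z = step i j (s n) (s n.+1) (walk i j s n z).
Proof. by []. Qed.

Lemma walkD i j s m n z :
  walk i j s (m + n) z = walk i j (fun k => s (m + k)%N) n (walk i j s m z).
Proof. by elim: n => [|n IH] /=; rewrite ?addn0 // addnS /= IH. Qed.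

Lemma eq_walk i j s s' n z : (forall k, (k <= n)%N -> s k = s' k) ->
  walk i j s n z = walk i j s' n z.
Proof.
elim: n => //= n IH ss'; rewrite !ss' // IH // => k kn.
by rewrite ss' // ltnW.
Qed.

Section cocycle.
Variables (i j : nat) (e : R).
Hypotheses (i0 : (0 < i)%N) (j0 : (0 < j)%N) (ij : i != j) (eij : tight i j e).

Lemma walk_short s n z :
  (forall k l, (k <= n)%N -> (l <= n)%N -> close e (val (s k)) (val (s l))) ->
  walk i j s n z = step i j (s 0%N) (s n) z.
Proof.
elim: n => [|n IH] cl /=; first by rewrite step_refl.
rewrite IH => [|k l kn ln]; last by apply: cl; exact: leqW.
by apply: (@step_comp _ _ e) => //; exact: cl.
Qed.

(** By [walk_short], a small group of steps amounts to the single step that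
    spans it. *)
Lemma walk_refine s m r z :
  (forall k l h, (k < m)%N -> (l <= r)%N -> (h <= r)%N ->
     close e (val (s (k * r + l)%N)) (val (s (k * r + h)%N))) ->
  walk i j s (m * r) z = walk i j (fun k => s (k * r)%N) m z.
Proof.
elim: m => [//|m IH] cl; rewrite mulSnr walkD IH; last first.
  by move=> k l h km; apply: cl; exact: ltnW.
rewrite walk_short => [|l h lr hr]; last exact: cl.
by rewrite /= addn0 mulSnr.
Qed.

(** Two neighbouring walks are conjugate by the steps that join them: the
    squares between them split into small triangles. *)
Lemma walk_close s s' n z :
  (forall k, (k <= n)%N -> close e (val (s k)) (val (s' k))) ->
  (forall k, (k < n)%N -> [/\ close e (val (s k)) (val (s k.+1)),
     close e (val (s' k)) (val (s' k.+1)) &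
     close e (val (s k)) (val (s' k.+1))]) ->
  step i j (s n) (s' n) (walk i j s n z) = walk i j s' n (step i j (s 0%N) (s' 0%N) z).
Proof.
elim: n => [//|n IH] ss' cl /=.
have [c1 c2 c3] := cl n (ltnSn n).
rewrite -IH; first last.
- by move=> k kn; apply: cl; exact: ltnW.
- by move=> k kn; apply: ss'; exact: leqW.
rewrite (@step_comp _ _ e) //; last by apply: ss'.
by rewrite (@step_comp _ _ e) //; apply: ss'.
Qed.

End cocycle.

End walk.

(** * Uniform closeness of loops *)

Section uniform.
Context {R : realType}.
Local Notation I := (unit_interval R).
Local Notation L := (loop_space R (HE_base R)).
Local Notation loop := ({path I from HE_base R to HE_base R in HE R})%type.

Definition loop_close (e : R) (f g : loop) : Prop :=
  forall t, close e (val (f t)) (val (g t)).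

Lemma ball_close (u v : R * R) e : ball u e v <-> close e u v.
Proof. by split=> -[] *; split. Qed.

(** Uniform continuity on the compact square, with moduli [1 / m] so that
    they fit the grids of mesh [1 / m] used below. *)
Lemma square_modulus (F : I * I -> HE R) (e : R) : continuous F -> 0 < e ->
  exists2 m, (0 < m)%N & forall a a' b b' : I,
    `|val a - val a'| <= m%:R^-1 -> `|val b - val b'| <= m%:R^-1 ->
    close e (val (F (a, b))) (val (F (a', b'))).
Proof.
move=> cF e0; pose G (x : R * R) : R * R := val (F (clamp x.1, clamp x.2)).
have cG : continuous G.
  have cFc : continuous (fun x : R * R => F (clamp x.1, clamp x.2)).
    by apply: continuous_comp2 cF; cts_tac.
  by apply: continuous_comp2 cFc _; exact: initial_continuous.
have /compact_near_coveringP cov : compact (`[0, 1]%classic `*` `[0, 1]%classic : set (R * R)).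
  by apply: compact_setX; exact: segment_compact.
pose P m (x : R * R) := forall y : R * R, `|x.1 - y.1| <= m.+1%:R^-1 ->
   `|x.2 - y.2| <= m.+1%:R^-1 -> close e (G x) (G y).
have [|N _ PN] := cov nat \oo P _.
  move=> x _; have e2 : 0 < e / 2 by rewrite divr_gt0.
  have /cG : nbhs (G x) (ball (G x) (e / 2)) by exact: nbhsx_ballx.
  rewrite -nbhs_ballE => -[d /= d0 dG].
  exists (ball x (d / 2), [set m : nat | m.+1%:R^-1 < d / 2]).
    split => /=; first by apply: nbhsx_ballx; rewrite divr_gt0.
    have d2 : 0 < d / 2 by rewrite divr_gt0.
    exact: (near_infty_natSinv_lt (PosNum d2)).
  move=> [x' m] /= [xx' md] y y1 y2.
  have -> : e = e / 2 + e / 2 by rewrite -splitr.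
  apply: (@close_trans _ _ _ _ (G x)).
    apply: close_sym; apply/ball_close/dG; apply: le_ball xx'.
    by lra.
  apply/ball_close/dG; rewrite [d]splitr; apply: ball_triangle xx' _.
  by split; [apply: le_lt_trans y1 md|apply: le_lt_trans y2 md].
exists N.+1 => // a a' b b' aa' bb'.
have := PN N (leqnn N) (val a, val b) _ (val a', val b') aa' bb'.
by rewrite /G /= !valK01; apply; split; rewrite /= in_itv; exact: unit_intervalP.
Qed.

Lemma entourage_HE (E : set (HE R * HE R)) : entourage E <->
  exists2 e : R, 0 < e & forall a b, close e (val a) (val b) -> E (a, b).
Proof.
split.
  move=> [V]; rewrite -entourage_ballE => -[e /= e0 eV] VE; exists e => // a b ab.
  by apply/VE/eV.
move=> [e e0 eE]; exists [set xy | ball xy.1 e xy.2].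
  by rewrite -entourage_ballE; exists e.
by move=> [a b] /= ab; apply: eE.
Qed.

Definition loop_near (f : loop) (P : loop -> Prop) : Prop :=
  exists2 e : R, 0 < e & forall g, loop_close e f g -> P g.

Lemma loop_nearS (f : loop) (P Q : loop -> Prop) :
  (forall g, P g -> Q g) -> loop_near f P -> loop_near f Q.
Proof. by move=> PQ [e e0 eP]; exists e => // g /eP /PQ. Qed.

Lemma loop_nearT (f : loop) (P : loop -> Prop) : (forall g, P g) -> loop_near f P.
Proof. by exists 1. Qed.

Lemma loop_nearI (f : loop) (P Q : loop -> Prop) :
  loop_near f P -> loop_near f Q -> loop_near f (fun g => P g /\ Q g).
Proof.
move=> [d d0 dP] [e e0 eQ]; exists (Order.min d e); first by rewrite lt_min d0.
move=> g fg; split; [apply: dP|apply: eQ] => t; apply: close_le (fg t);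
  by rewrite ge_min lexx ?orbT.
Qed.

Lemma loop_near_forall_lt (f : loop) b (P : nat -> loop -> Prop) :
  (forall n, (n < b)%N -> loop_near f (P n)) ->
  loop_near f (fun g => forall n, (n < b)%N -> P n g).
Proof.
elim: b => [|b IH] Pb; first exact: loop_nearT.
have := loop_nearI (IH (fun n nb => Pb n (ltnW nb))) (Pb b (ltnSn b)).
apply: loop_nearS => g [Pg Pbg] n.
by rewrite ltnS leq_eqVlt => /predU1P[->|/Pg].
Qed.

(** The sets [loop_close e f] form a basis of neighbourhoods of [f], because
    the uniformity of the earring is induced from the plane. *)
Lemma nbhs_loop (f : loop) (P : set L) : nbhs (f : L) P <-> loop_near f P.
Proof.
split.
  rewrite nbhsE => -[U [[W oW <-] Wf] UP].
  have : nbhs (f : {uniform I -> HE R}) W by apply: open_nbhs_nbhs.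
  move=> /uniform_nbhs[E [/entourage_HE[e e0 eE] EW]].
  by exists e => // g fg; apply/UP/EW => t _; apply: eE.
move=> [e e0 eP]; pose E := [set ab : HE R * HE R | close e (val ab.1) (val ab.2)].
have : nbhs (f : {uniform I -> HE R}) [set h | forall t, [set: I] t -> E (f t, h t)].
  by apply/uniform_nbhs; exists E; split => //; apply/entourage_HE; exists e.
move=> /(@initial_continuous L _ (fun f : L => ((f : loop) : {uniform I -> HE R}))).
apply: (@filterS L (nbhs (f : L)) _) => g /= fg; apply: eP => t; exact: fg.
Qed.

End uniform.

(** * Holonomy: local constancy, homotopy invariance, concatenation *)

Section holonomy.
Context {R : realType}.
Local Notation I := (unit_interval R).
Local Notation loop := ({path I from HE_base R to HE_base R in HE R})%type.
Implicit Types (f g h : I -> HE R) (i j k l m n r : nat) (e : R) (z : int).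

Lemma clamp_lipschitz (x y : R) : `|val (clamp x) - val (clamp y)| <= `|x - y|.
Proof.
rewrite /clamp /= /Order.max /Order.min.
wlog xy : x y / x <= y => [W|].
  by have [/W//|/ltW/W] := leP x y; rewrite distrC (distrC x).
rewrite distrC (distrC x) [leRHS]ger0_norm ?subr_ge0 // ler_norml.
have [x1|x1] := ltP x 1; have [y1|y1] := ltP y 1;
  repeat case: ltP => ?; lra.
Qed.

Definition fine e m f := forall a b : I, `|val a - val b| <= m%:R^-1 ->
  close e (val (f a)) (val (f b)).

Definition sample f m k : HE R := f (clamp (k%:R / m%:R)).

Lemma fine_sample e m f n k l : (0 < m)%N -> (0 < n)%N -> fine e m f ->
  (k * m <= l * m + n)%N -> (l * m <= k * m + n)%N ->
  close e (val (sample f n k)) (val (sample f n l)).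
Proof.
move=> m0 n0 fm kl lk; apply: fm; apply: le_trans (clamp_lipschitz _ _) _.
have M0 : 0 < m%:R :> R by rewrite ltr0n.
have N0 : 0 < n%:R :> R by rewrite ltr0n.
rewrite -mulrBl normrM [`|_^-1|]gtr0_norm ?invr_gt0 // ler_pdivrMr //.
rewrite mulrC ler_pdivlMr // -[X in _ * X](gtr0_norm M0) -normrM mulrBl ler_norml.
rewrite -!natrM; move: kl lk; rewrite -!(ler_nat R) !natrD => kl lk.
by apply/andP; split; lra.
Qed.

Lemma fine_le e e' m m' f : (0 < m)%N -> (m <= m')%N -> e <= e' -> fine e m f -> fine e' m' f.
Proof.
move=> m0 mm' ee' fm a b ab; apply: close_le ee' _; apply: fm.
by apply: le_trans ab _; rewrite lef_pV2 ?posrE ?ltr0n ?ler_nat // (leq_trans m0).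
Qed.

Lemma fine_exists e f : continuous f -> 0 < e -> exists2 m, (0 < m)%N & fine e m f.
Proof.
move=> cf e0.
have cF : continuous (fun x : I * I => f x.1) by apply: continuous_comp2 cf; exact: cts_fst.
have [m m0 fm] := square_modulus cF e0; exists m => // a b ab.
by apply: (fm a b a a) => //; rewrite subrr normr0 invr_ge0.
Qed.

Definition adapted i j f m : Prop :=
  (0 < m)%N /\ exists2 e, tight i j e & fine e m f.

(** The value does not depend on the adapted sampling, see [holonomyE]; the
    default [0] is never reached for a continuous [f]. *)
Definition holonomy i j f z : int :=
  let m := xget 0%N (adapted i j f) in walk i j (sample f m) m z.

Section holonomy_theory.
Variables i j : nat.
Hypotheses (i0 : (0 < i)%N) (j0 : (0 < j)%N) (ij : i != j).

Lemma adapted_exists f : continuous f -> exists m, adapted i j f m.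
Proof.
move=> cf; have [e tij] := tight_exists (R := R) i0 j0.
by have [e0 _ _] := tij; have [m m0 fm] := fine_exists cf e0; exists m; split=> //; exists e.
Qed.

Lemma adapted_mul f m r : (0 < r)%N -> adapted i j f m -> adapted i j f (m * r).
Proof.
move=> r0 [m0 [e te fm]]; split; first by rewrite muln_gt0 m0.
by exists e => //; apply: fine_le fm; rewrite // leq_pmulr.
Qed.

Lemma walk_sample_refine f m r z : (0 < r)%N -> adapted i j f m ->
  walk i j (sample f (m * r)) (m * r) z = walk i j (sample f m) m z.
Proof.
move=> r0 [m0 [e te fm]].
rewrite (@walk_refine _ i j e) //.
  apply: eq_walk => k _; rewrite /sample natrM natrM; congr (f (clamp _)).
  by rewrite -mulf_div divff ?mulr1 // pnatr_eq0 -lt0n.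
move=> k l h km lr hr; apply: (@fine_sample _ m) => //; first by rewrite muln_gt0 m0.
  rewrite !mulnDl -addnA leq_add2l; nia.
rewrite !mulnDl -addnA leq_add2l; nia.
Qed.

(** Two adapted samplings have a common refinement. *)
Lemma holonomyE f m z : adapted i j f m ->
  holonomy i j f z = walk i j (sample f m) m z.
Proof.
move=> fm; rewrite /holonomy.
have fn : adapted i j f (xget 0%N (adapted i j f)) by apply: xgetPex; exists m.
set n := xget _ _ in fn *.
rewrite -(walk_sample_refine z fm.1 fn) mulnC.
by rewrite (walk_sample_refine z fn.1 fm).
Qed.

Lemma eq_holonomy f g : f =1 g -> holonomy i j f =1 holonomy i j g.
Proof. by move=> /funext ->. Qed.

Lemma sample0 f m : sample f m 0 = f zero.
Proof. by rewrite /sample mul0r. Qed.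

Lemma sample_last f m : (0 < m)%N -> sample f m m = f one.
Proof. by move=> m0; rewrite /sample divff // pnatr_eq0 -lt0n. Qed.

(** The constant [4] leaves room for the diagonal jumps from [f] to [g], and
    for [g] itself to be sampled finely enough: a step of [g] costs one step
    of [f] and two passages between [f] and [g]. *)
Lemma holonomy_close f g e m z : tight i j e -> (0 < m)%N -> fine (e / 4) m f ->
  f zero = g zero -> f one = g one ->
  (forall a, close (e / 4) (val (f a)) (val (g a))) ->
  holonomy i j f z = holonomy i j g z.
Proof.
move=> te m0 fm fg0 fg1 fg; have [e0 _ _] := te.
have e4 : e / 4 <= e by lra.
have gm : fine e m g.
  move=> a b /fm fab; have gfa := close_sym (fg a).
  apply: close_le (close_trans gfa (close_trans fab (fg b))); lra.
have fme : fine e m f by exact: fine_le fm.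
rewrite (@holonomyE f m) ?(@holonomyE g m); first last.
- by split=> //; exists e.
- by split=> //; exists e.
have := @walk_close _ i j e i0 j0 ij te (sample f m) (sample g m) m z.
rewrite !sample0 !sample_last // fg0 fg1 !step_refl; apply.
  by move=> k _; apply: close_le e4 _; exact: fg.
move=> k km; split.
- by apply: (@fine_sample _ m) => //; rewrite mulSn; lia.
- by apply: (@fine_sample _ m) => //; rewrite mulSn; lia.
- have c1 : close (e / 4) (val (sample f m k)) (val (sample f m k.+1)).
    by apply: (@fine_sample _ m) => //; rewrite mulSn; lia.
  by apply: close_le (close_trans c1 (fg _)); lra.
Qed.

Lemma holonomy_locally_constant (f : loop) :
  loop_near f (fun g : loop => holonomy i j f =1 holonomy i j g).
Proof.
have [e te] := tight_exists (R := R) i0 j0; have [e0 _ _] := te.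
have e4 : 0 < e / 4 by rewrite divr_gt0.
have [m m0 fm] := fine_exists (@cts_fun _ _ f) e4.
exists (e / 4) => // g fg z; apply: holonomy_close fm _ _ fg => //.
  exact: etrans path_zero (esym path_zero).
exact: etrans path_one (esym path_one).
Qed.

(** Consecutive rows of a fine grid on the homotopy are uniformly close loops. *)
Lemma holonomy_homotopic (f g : loop) : path_homotopic f g ->
  holonomy i j f =1 holonomy i j g.
Proof.
move=> [H [cH Hf Hg H0 H1]] z.
have [e te] := tight_exists (R := R) i0 j0; have [e0 _ _] := te.
have e4 : 0 < e / 4 by rewrite divr_gt0.
have [m m0 Hm] := square_modulus cH e4.
pose row k (a : I) := H (a, clamp (k%:R / m%:R)).
have rowE k : holonomy i j (row k) z = holonomy i j (row 0%N) z.
  elim: k => [//|k <-]; apply/esym; apply: (@holonomy_close _ _ e m) => //.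
  - by move=> a b ab; apply: Hm => //; rewrite subrr normr0 invr_ge0.
  - by rewrite /row !H0.
  - by rewrite /row !H1.
  - move=> a; apply: Hm; first by rewrite subrr normr0 invr_ge0.
    apply: le_trans (clamp_lipschitz _ _) _.
    rewrite -mulrBl -natr1 opprD addNKr normrM normrN1 mul1r.
    by rewrite ger0_norm // invr_ge0.
have -> : holonomy i j f z = holonomy i j (row 0%N) z.
  by apply: eq_holonomy => a; rewrite /row mul0r Hf.
rewrite -(rowE m); apply: eq_holonomy => a.
by rewrite /row divff ?Hg // pnatr_eq0 -lt0n.
Qed.

Lemma holonomy_cst (a : HE R) z : holonomy i j (cst a) z = z.
Proof.
rewrite (@holonomyE _ 1%N); first by rewrite /= step_refl.
split=> //; have [e te] := tight_exists (R := R) i0 j0; exists e => // b c _.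
by have [e0 _ _] := te; exact: close_refl.
Qed.

(** A sampling of the concatenation in [n + n] pieces consists of samplings of
    the two factors in [n] pieces, so it suffices to choose [n] adapted to all
    three paths. *)
Lemma holonomy_concat (x y w : HE R) (f : {path I from x to y in HE R})
    (g : {path I from y to w in HE R}) z :
  holonomy i j (concat f g) z = holonomy i j g (holonomy i j f z).
Proof.
have [a fa] := adapted_exists (@cts_fun _ _ f).
have [b gb] := adapted_exists (@cts_fun _ _ g).
have [c hc] := adapted_exists (@cts_fun _ _ (concat f g)).
have [a0 b0 c0] := And3 fa.1 gb.1 hc.1.
pose n := (a * b * c)%N.
have n0 : (0 < n)%N by rewrite !muln_gt0 a0 b0.
have fn : adapted i j f n by rewrite /n -mulnA; apply: adapted_mul; rewrite // muln_gt0 b0.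
have gn : adapted i j g n.
  by rewrite /n (mulnC a) -mulnA; apply: adapted_mul; rewrite // muln_gt0 a0.
have hn : adapted i j (concat f g) (n + n).
  by rewrite addnn -muln2 /n mulnAC mulnC; apply: adapted_mul => //; rewrite !muln_gt0 a0 b0.
rewrite (holonomyE _ fn) (holonomyE _ gn) (holonomyE _ hn) walkD.
clearbody n.
have N0 : n%:R != 0 :> R by rewrite pnatr_eq0 -lt0n.
have Np : 0 < n%:R :> R by rewrite ltr0n.
have -> : walk i j (sample (concat f g) (n + n)) n z = walk i j (sample f n) n z.
  apply: eq_walk => k kn; rewrite /sample concatE.
  have kN : k%:R <= n%:R :> R by rewrite ler_nat.
  have E : k%:R / (n + n)%:R = k%:R / n%:R / 2 :> R by rewrite natrD; field; lra.
  have k1 : 0 <= (k%:R / n%:R : R) <= 1.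
    by apply/andP; split; [exact: divr_ge0|rewrite ler_pdivrMr // mul1r].
  rewrite E clampE; last by move: k1; set q := _ / _; lra.
  rewrite ifT; last by move: k1; set q := _ / _; lra.
  by congr (f (clamp _)); field.
apply: eq_walk => k kn; rewrite /sample concatE.
have kN : k%:R <= n%:R :> R by rewrite ler_nat.
have E : (n + k)%:R / (n + n)%:R = 2^-1 + k%:R / n%:R / 2 :> R by rewrite !natrD; field; lra.
have k1 : 0 <= (k%:R / n%:R : R) <= 1.
  by apply/andP; split; [exact: divr_ge0|rewrite ler_pdivrMr // mul1r].
rewrite E clampE; last by move: k1; set q := _ / _; lra.
case: ifPn => q2; last first.
  by congr (g (clamp _)); field.
have -> : k%:R / n%:R = 0 :> R by move: k1 q2; set q := _ / _; lra.
rewrite mul0r addr0 divff //.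
exact: etrans path_one (esym path_zero).
Qed.

End holonomy_theory.
End holonomy.

(** * Bounding the number of alternations *)

Section alternation.
Context {R : realType}.
Local Notation I := (unit_interval R).
Local Notation loop := ({path I from HE_base R to HE_base R in HE R})%type.
Implicit Types (i j k l m n r b : nat) (z : int) (s : nat -> HE R).

(** The interval [-b .. b + 1] is symmetric under [z |-> 1 - z], whereas
    [z |-> - z] maps it into the next window. *)
Definition window b z : bool := (- b%:Z <= z <= b%:Z + 1)%R.

(** A piece of a walk of diameter below the mesh of [X_i] costs at most one
    window: either it never crosses [X_i] and the window is preserved, or it
    stays in the far half of [X_i], so that [X_j] is not crossed and the piece
    acts as the identity or as [z |-> - z]. *)
Lemma walk_piece i j s r b z : (0 < i)%N -> i != j ->
  (forall l h, (l <= r)%N -> (h <= r)%N -> close (mesh i) (val (s l)) (val (s h))) ->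
  window b z -> window b.+1 (walk i j s r z).
Proof.
move=> i0 ij cl bz.
have [[l lr cr]|ncr] := pselect (exists2 l, (l < r)%N & crossing i (val (s l)) (val (s l.+1))).
  have noj h : (h < r)%N -> crossing j (val (s h)) (val (s h.+1)) = false.
    move=> hr; apply: crossing_disjoint cr => //; first exact: HE_val.
      by apply: cl => //; exact: ltnW.
    by apply: cl; exact: ltnW.
  have : forall n, (n <= r)%N -> walk i j s n z = z \/ walk i j s n z = - z.
    elim=> [|n IH] nr /=; first by left.
    rewrite /step noj //; case: (IH (ltnW nr)) => ->; case: ifP => _; rewrite ?opprK; auto.
  by move=> /(_ r (leqnn r)) []->; move: bz; rewrite /window; lia.
have : forall n, (n <= r)%N -> window b (walk i j s n z).
  elim=> [|n IH] nr //=; rewrite /step ifF; last first.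
    by apply/negP => cr; apply: ncr; exists n.
  by have := IH (ltnW nr); rewrite /window; case: ifP => _; lia.
by move=> /(_ r (leqnn r)); rewrite /window; lia.
Qed.

(** The number [m] of pieces into which [0, 1] must be cut is dictated by [f]
    and [i] alone; each of them may need a much finer sampling, depending on
    [g] and [j], but it is still one piece in the sense of [walk_piece]. *)
Lemma holonomy_window i (f : loop) : (0 < i)%N ->
  exists b, loop_near f (fun g =>
    forall j, (0 < j)%N -> i != j -> window b (holonomy i j g 0)).
Proof.
move=> i0; have e4 : (0 : R) < mesh i / 4 by rewrite divr_gt0 ?mesh_gt0.
have [m m0 fm] := fine_exists (@cts_fun _ _ f) e4.
exists m, (mesh i / 4) => // g fg j j0 ij.
have gm : fine (mesh i) m g.
  move=> a b /fm fab; apply: close_le (close_trans (close_sym (fg a)) (close_trans fab (fg b))).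
  lra.
have [r ar] := adapted_exists i0 j0 (@cts_fun _ _ g).
have r0 := ar.1.
have am : adapted i j g (m * r) by rewrite mulnC; exact: adapted_mul.
rewrite (holonomyE i0 j0 ij _ am).
have : forall k, (k <= m)%N -> window k (walk i j (sample g (m * r)) (k * r) 0).
  elim=> [//|k IH] km; rewrite mulSnr walkD.
  apply: walk_piece => //; last by apply: IH; exact: ltnW.
  move=> l h lr hr; apply: (@fine_sample _ _ m) => //; first by rewrite muln_gt0 m0.
    rewrite !mulnDl -addnA leq_add2l; nia.
  rewrite !mulnDl -addnA leq_add2l; nia.
exact.
Qed.

End alternation.

(** * The loops around the circles *)

Section circle_loop.
Context {R : realType}.
Local Notation I := (unit_interval R).
Local Notation loop := ({path I from HE_base R to HE_base R in HE R})%type.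
Implicit Types (i j k : nat) (z : int) (t : I) (up : bool).

(** The point of [X_{k+1}] of abscissa [2 x / (k + 1)], on the upper or the
    lower half circle. *)
Definition arc_point k up (x : R) : R * R :=
  (2 / k.+1%:R * x, (-1) ^+ (~~ up) * (2 / k.+1%:R * Num.sqrt (x * (1 - x)))).

Lemma arc_point_on_circle k up t : on_circle k.+1 (arc_point k up (val t)).
Proof.
have /andP[t0 t1] := unit_intervalP t.
rewrite /on_circle /= !exprMn sqrr_sign mul1r sqr_sqrtr; last first.
  by rewrite mulr_ge0 // subr_ge0.
have K0 : k.+1%:R != 0 :> R by rewrite pnatr_eq0.
by set K := k.+1%:R in K0 *; apply/eqP; field.
Qed.

Lemma arc_point_in k up t : arc_point k up (val t) \in @hawaiian_earring R.
Proof. by rewrite inE; apply/mem_earring; exists k.+1; rewrite ?arc_point_on_circle. Qed.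

Definition arc_fun k up t : HE R :=
  exist (fun u => u \in @hawaiian_earring R) _ (arc_point_in k up t).

Definition antipode k : HE R := arc_fun k true one.

Lemma arc_continuous k up : continuous (arc_fun k up).
Proof.
apply: continuous_comp_initial => t /=.
move: t; apply: cts_pair; first by cts_tac.
apply: cts_mul; first exact: cts_cst.
apply: cts_mul; first exact: cts_cst.
have cs : continuous (fun t : I => val t * (1 - val t)) by cts_tac.
by apply: continuous_comp2 cs _; exact: sqrt_continuous.
Qed.

Lemma arc_zero k up : arc_fun k up zero = HE_base R.
Proof. by apply: val_inj; rewrite /= /arc_point val01E mul0r sqrtr0 !mulr0. Qed.

Lemma arc_one k up : arc_fun k up one = antipode k.
Proof.
by apply: val_inj; rewrite /= /arc_point val01E subrr mulr0 sqrtr0 !mulr0.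
Qed.

Definition arc k up : {path I from HE_base R to antipode k in HE R} :=
  mk_path (@arc_continuous k up) (@arc_zero k up) (@arc_one k up).

Lemma arc_on_circle k up t : on_circle k.+1 (val (arc k up t)).
Proof. exact: arc_point_on_circle. Qed.

Definition circle_loop k : loop := concat (arc k true) (reverse (arc k false)).

Section holonomy_of_loops.
Variables i j : nat.
Hypotheses (i0 : (0 < i)%N) (j0 : (0 < j)%N) (ij : i != j).

(** This determines the holonomy of the reversed path when that of [f] is
    onto. *)
Lemma holonomy_reverse (y : HE R) (f : {path I from HE_base R to y in HE R}) z :
  holonomy i j (reverse f) (holonomy i j f z) = z.
Proof.
rewrite -(holonomy_concat i0 j0 ij f (reverse f)).
rewrite (holonomy_homotopic i0 j0 ij (concat_reverse_r f)).
exact: holonomy_cst.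
Qed.

Definition reflection k z : int :=
  if i == k.+1 then - z else if j == k.+1 then 1 - z else z.

Lemma reflectionK k : involutive (reflection k).
Proof.
move=> z; rewrite /reflection.
by case: (i == _); [rewrite opprK|case: (j == _); rewrite ?subKr].
Qed.

Lemma crossing_arc k up m t t' :
  crossing m (val (arc k up t)) (val (arc k up t')) -> m = k.+1.
Proof.
by move=> /and3P[ft _ _]; apply: far_circle_unique ft (arc_on_circle k up t).
Qed.

Lemma holonomy_upper_arc k z : holonomy i j (arc k true) z = z.
Proof.
have [m am] := adapted_exists i0 j0 (@cts_fun _ _ (arc k true)).
have side_up t : side (val (arc k true t)) = false.
  by apply/negbTE; rewrite /side -leNgt /= mul1r mulr_ge0 ?sqrtr_ge0 // divr_ge0.
have nc l t t' : crossing l (val (arc k true t)) (val (arc k true t')) = false.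
  by rewrite /crossing !side_up eqxx !andbF.
rewrite (holonomyE i0 j0 ij _ am); elim: {2}m => //= n ->.
by rewrite /step !nc.
Qed.

(** A primitive of the crossings along the lower arc: it is false only at the
    antipodal point, which counts as upper. *)
Definition past_antipode k (u : R * R) : bool := side u || ~~ far k.+1 u.

(** A far point of the lower arc other than the antipodal one is on the lower
    side; and no point outside the far half is close to the antipodal one. *)
Lemma crossing_lower_arc k t t' :
  let u := val (arc k false t) in let v := val (arc k false t') in
  close (mesh k.+1) u v ->
  crossing k.+1 u v = past_antipode k u (+) past_antipode k v.
Proof.
move=> u v uv.
have one_far (t1 t2 : I) : close (mesh k.+1) (val (arc k false t1)) (val (arc k false t2)) ->
    far k.+1 (val (arc k false t2)) -> ~~ far k.+1 (val (arc k false t1)) ->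
    side (val (arc k false t2)).
  set a := val (arc k false t1); set b := val (arc k false t2).
  move=> [ab _] /andP[/eqP b1 b2]; rewrite /far arc_on_circle andTb -leNgt => a1.
  have b0 : b.2 <= 0.
    by rewrite /b /= expr1 mulN1r oppr_le0 mulr_ge0 ?sqrtr_ge0 // divr_ge0.
  rewrite /side lt_neqAle b0 andbT; apply/negP => /eqP b20.
  have K1 : 1 <= k.+1%:R :> R by rewrite ler1n.
  have Kd := natr_mesh (R := R) (ltn0Sn k).
  move: ab; rewrite ltr_norml => /andP[ab _].
  have Kab : k.+1%:R * (b.1 - mesh k.+1) <= k.+1%:R * a.1 by rewrite ler_pM2l; lra.
  have {}b1 : k.+1%:R * b.1 ^+ 2 = 2 * b.1 by rewrite -b1 b20 expr0n addr0.
  rewrite mulrBr in Kab.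
  have : k.+1%:R * b.1 <= 1 + 1 / 32 by lra.
  set K : R := k.+1%:R in b1 b2 *; move: b.1 b1 b2 => x; nra.
rewrite /crossing /past_antipode.
have [fu|fu] := boolP (far k.+1 u); have [fv|fv] := boolP (far k.+1 v); rewrite ?orbT ?orbF //=.
- by case: (side u); case: (side v).
- by rewrite (one_far t' t (close_sym uv)).
- by rewrite (one_far t t' uv).
Qed.

Lemma holonomy_lower_arc k z : holonomy i j (arc k false) z = reflection k z.
Proof.
have [m am] := adapted_exists i0 j0 (@cts_fun _ _ (arc k false)).
rewrite (holonomyE i0 j0 ij _ am).
have [m0 [e [e0 ei ej] fm]] := am.
have st n w : (n < m)%N ->
    step i j (sample (arc k false) m n) (sample (arc k false) m n.+1) w =
    if past_antipode k (val (sample (arc k false) m n)) (+)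
       past_antipode k (val (sample (arc k false) m n.+1)) then reflection k w else w.
  move=> nm.
  have cl : close e (val (sample (arc k false) m n)) (val (sample (arc k false) m n.+1)).
    by apply: (@fine_sample _ _ m) => //; rewrite mulSn; lia.
  have nc l : l != k.+1 -> crossing l (val (sample (arc k false) m n))
       (val (sample (arc k false) m n.+1)) = false.
    by move=> lk; apply: contraNF lk => /crossing_arc ->.
  rewrite /step /reflection; have [ik|ik] := eqVneq i k.+1.
    have jk : j != k.+1 by rewrite -ik eq_sym.
    rewrite (nc j) // ik -crossing_lower_arc //; last by rewrite -ik; exact: close_le cl.
  rewrite (nc i) //; have [jk|jk] := eqVneq j k.+1.
    by rewrite jk -crossing_lower_arc //; rewrite -jk; exact: close_le cl.
  by rewrite nc // if_same.
have : forall n, (n <= m)%N -> walk i j (sample (arc k false) m) n z =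
    if past_antipode k (val (sample (arc k false) m n)) then z else reflection k z.
  elim=> [_|n IH nm].
    by rewrite sample0 path_zero /past_antipode /far /= mulr0 ltr10 andbF orbT.
  rewrite walkS st // IH ?(ltnW nm) //.
  by do 2 case: (past_antipode _ _) => //=; rewrite reflectionK.
move=> /(_ m (leqnn m)) ->; rewrite sample_last // path_one ifF //.
rewrite /past_antipode /far (arc_point_on_circle k true one) /side /=.
have K0 : k.+1%:R != 0 :> R by rewrite pnatr_eq0.
rewrite val01E subrr mulr0 sqrtr0 !mulr0 ltxx /= mulr1 mulrCA divff // mulr1.
by rewrite ltr1n.
Qed.

Lemma holonomy_circle_loop k z : holonomy i j (circle_loop k) z = reflection k z.
Proof.
rewrite (holonomy_concat i0 j0 ij) holonomy_upper_arc -{1}(reflectionK k z).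
by rewrite -holonomy_lower_arc holonomy_reverse.
Qed.

End holonomy_of_loops.
End circle_loop.

(** * Oscillating loops *)

Section oscillation.
Context {R : realType}.
Local Notation I := (unit_interval R).
Local Notation L := (loop_space R (HE_base R)).
Local Notation loop := ({path I from HE_base R to HE_base R in HE R})%type.
Local Notation base_loop := (cst (HE_base R) : loop).
Local Notation q := (@loop_class R (HE R) (HE_base R)).
Implicit Types (f g h : loop) (k l m n b : nat) (e : R) (z : int).

Definition winds n k f : bool :=
  ~~ window n (holonomy 1 k.+1 f 0) && ~~ window k (holonomy n.+1 k.+1 f 0).

Definition oscillating f : Prop := exists n k, [/\ (0 < n)%N, (n < k)%N & winds n k f].

Lemma winds_holonomy n k f g :
  holonomy 1 k.+1 f =1 holonomy 1 k.+1 g ->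
  holonomy n.+1 k.+1 f =1 holonomy n.+1 k.+1 g -> winds n k f = winds n k g.
Proof. by move=> fg fg'; rewrite /winds fg fg'. Qed.

Lemma oscillating_homotopic f g : path_homotopic f g -> oscillating f -> oscillating g.
Proof.
move=> fg [n [k [n0 nk fnk]]]; exists n, k; split=> //; move: fnk.
by rewrite /winds !(holonomy_homotopic _ _ _ fg) //; lia.
Qed.

Lemma window_le b b' z : (b <= b')%N -> window b z -> window b' z.
Proof. rewrite /window; lia. Qed.

Lemma near_not_winds f n k : (0 < n < k)%N -> ~~ winds n k f ->
  loop_near f (fun g : loop => ~~ winds n k g).
Proof.
move=> /andP[n0 nk] nw.
have k1 : (1 != k.+1)%N by lia.
have nk1 : (n.+1 != k.+1)%N by lia.
have H1 := holonomy_locally_constant (ltn0Sn 0) (ltn0Sn k) k1 f.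
have H2 := holonomy_locally_constant (ltn0Sn n) (ltn0Sn k) nk1 f.
apply: loop_nearS (loop_nearI H1 H2) => g [g1 g2].
by rewrite -(winds_holonomy g1 g2).
Qed.

(** The window of [X_1] leaves finitely many [n]; for each of them the window of
    [X_{n+1}] leaves finitely many [k]; and for each remaining pair the
    holonomies are locally constant. *)
Lemma near_not_oscillating f : ~ oscillating f -> loop_near f (fun g : loop => ~ oscillating g).
Proof.
move=> nf; have [b Hb] := holonomy_window f (ltn0Sn 0).
have Hn n : (n < b)%N ->
    loop_near f (fun g : loop => (0 < n)%N -> forall k, (n < k)%N -> ~~ winds n k g).
  move=> nb; have [n0|n0] := leqP n 0; first exact: loop_nearT.
  have [c Hc] := holonomy_window f (ltn0Sn n).
  have Hk k : (k < c)%N -> loop_near f (fun g : loop => (n < k)%N -> ~~ winds n k g).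
    move=> kc; have [nk|nk] := ltnP n k; last exact: loop_nearT.
    have nw : ~~ winds n k f by apply/negP => w; apply: nf; exists n, k.
    by apply: loop_nearS (near_not_winds _ nw) => [g //|]; rewrite n0.
  apply: loop_nearS (loop_nearI Hc (loop_near_forall_lt Hk)) => g [gc gk] _ k nk.
  have [kc|ck] := ltnP k c; first exact: gk.
  by rewrite /winds (window_le ck) ?andbF // gc //; lia.
apply: loop_nearS (loop_nearI Hb (loop_near_forall_lt Hn)) => g [gb gn].
move=> [n [k [n0 nk w]]]; have [nb|bn] := ltnP n b; first by have := gn n nb n0 k nk; rewrite w.
by move: w; rewrite /winds (window_le bn) // gb //; lia.
Qed.

Fixpoint power f n : loop := if n is n'.+1 then concat f (power f n') else base_loop.

(** [a(n, k)], a loop within the circles [X_{n+1}] and [X_{k+1}].  The even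
    exponent makes the holonomy for [(X_1, X_{k+1})] trivial. *)
Definition small_oscillation n k : loop := power (concat (circle_loop n) (circle_loop k)) k.+2.*2.

(** [w(n, k)] when [c] is the loop around [X_{k+1}], and its limit as [k] grows
    when [c] is constant. *)
Definition large_oscillation (c : loop) n : loop :=
  power (concat (concat (circle_loop 0) c) (concat (reverse (circle_loop 0)) c)) n.+2.

Lemma holonomy_power i j f n z : (0 < i)%N -> (0 < j)%N -> i != j ->
  holonomy i j (power f n) z = iter n (holonomy i j f) z.
Proof.
move=> i0 j0 ij; elim: n z => [|n IH] z; first exact: holonomy_cst.
by rewrite [LHS](holonomy_concat i0 j0 ij) IH -iterSr.
Qed.

Lemma iter_translation (F : int -> int) (c : int) n z :
  (forall x, F x = x + c) -> iter n F z = z + n%:Z * c.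
Proof. by move=> Fc; elim: n => [|n IH] /=; rewrite ?Fc ?IH; lia. Qed.

Lemma iter_involution (F : int -> int) n z : involutive F -> iter n.*2 F z = z.
Proof. by move=> FK; elim: n => [|n IH] //; rewrite doubleS !iterS FK. Qed.

Lemma holonomy_reverse_circle i j k z : (0 < i)%N -> (0 < j)%N -> i != j ->
  holonomy i j (reverse (@circle_loop R k)) z = reflection i j k z.
Proof.
move=> i0 j0 ij; rewrite -{1}[z](reflectionK i j k) -(@holonomy_circle_loop R _ _ i0 j0 ij).
exact: (holonomy_reverse i0 j0 ij).
Qed.

(** For [(X_1, X_{k+1})] the first factor acts trivially and the second one as
    the translation by [2 (n + 2)]; for [(X_{n+1}, X_{k+1})] the first factor
    acts as the translation by [2 (k + 2)] and the second one trivially. *)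
Lemma oscillating_witness n k : (0 < n)%N -> (n < k)%N ->
  oscillating (concat (small_oscillation n k) (large_oscillation (circle_loop k) n)).
Proof.
move=> n0 nk; exists n, k; split=> //; rewrite /winds.
have n1k : (n.+1 != k.+1)%N by lia.
have k1 : (1 != k.+1)%N by lia.
have n1 : (1 == n.+1)%N = false by lia.
have kn : (k.+1 == n.+1)%N = false by lia.
have kS : (k.+1 == 1)%N = false by lia.
have nS : (n.+1 == 1)%N = false by lia.
have ab i j z : (0 < i)%N -> (0 < j)%N -> i != j ->
    holonomy i j (concat (circle_loop n) (@circle_loop R k)) z =
    reflection i j k (reflection i j n z).
  move=> i0 j0 ij; rewrite (holonomy_concat i0 j0 ij (circle_loop n) (circle_loop k)).
  by rewrite !holonomy_circle_loop.
have block i j z : (0 < i)%N -> (0 < j)%N -> i != j ->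
    holonomy i j (concat (concat (circle_loop 0) (circle_loop k))
      (concat (reverse (circle_loop 0)) (@circle_loop R k))) z =
    reflection i j k (reflection i j 0 (reflection i j k (reflection i j 0 z))).
  move=> i0 j0 ij; rewrite (holonomy_concat i0 j0 ij (concat _ _) (concat _ _)).
  rewrite (holonomy_concat i0 j0 ij (circle_loop 0) (circle_loop k)).
  rewrite (holonomy_concat i0 j0 ij (reverse _) (circle_loop k)).
  by rewrite holonomy_reverse_circle // !holonomy_circle_loop.
apply/andP; split.
  rewrite holonomy_concat // !holonomy_power // iter_involution => [|z]; last first.
    by rewrite !ab // /reflection n1 eqxx (negbTE k1) kn subKr.
  rewrite (@iter_translation _ 2) => [|z]; last first.
    by rewrite block // /reflection eqxx (negbTE k1) eqxx; lia.
  rewrite /window; lia.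
rewrite holonomy_concat // !holonomy_power //.
rewrite (@iter_translation _ 1 k.+2.*2) => [|z]; last first.
  by rewrite ab // /reflection !eqxx (negbTE n1k); lia.
rewrite (@iter_translation _ 0) => [|z]; last first.
  by rewrite block // /reflection nS kS eqxx (negbTE n1k); lia.
rewrite /window; lia.
Qed.

Lemma not_oscillating_base : ~ oscillating base_loop.
Proof.
move=> [n [k [n0 nk /andP[w _]]]]; have k1 : (1 != k.+1)%N by lia.
by move: w; rewrite holonomy_cst // /window; lia.
Qed.

Lemma concat_close e f f' g g' : loop_close e f f' -> loop_close e g g' ->
  loop_close e (concat f g) (concat f' g').
Proof. by move=> ff gg t; rewrite !concatE; case: ifP. Qed.

Lemma power_close e f g n : 0 < e -> loop_close e f g -> loop_close e (power f n) (power g n).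
Proof.
move=> e0 fg; elim: n => [|n IH] /=; first by move=> t; exact: close_refl.
exact: concat_close.
Qed.

Lemma base_close_concat e f g : loop_close e base_loop f -> loop_close e base_loop g ->
  loop_close e base_loop (concat f g).
Proof.
by move=> ff gg t; rewrite concatE; case: ifP => _; [exact: (ff (clamp _))|exact: (gg (clamp _))].
Qed.

Lemma base_close_power e f n : 0 < e -> loop_close e base_loop f ->
  loop_close e base_loop (power f n).
Proof.
move=> e0 fg; elim: n => [|n IH] /=; first by move=> t; exact: close_refl.
exact: base_close_concat.
Qed.

Lemma circle_loop_small e : 0 < e -> exists N, forall k, (N <= k)%N ->
  loop_close e base_loop (circle_loop k).
Proof.
move=> e0; have e2 : 0 < e / 2 by rewrite divr_gt0.
have [N _ HN] := near_infty_natSinv_lt (PosNum e2).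
exists N => k /HN /= ke t.
have K0 : 0 < k.+1%:R^-1 :> R by rewrite invr_gt0 ltr0n.
have arc_small up (s : I) : close e (val (HE_base R)) (val (arc k up s)).
  have /andP[s0 s1] := unit_intervalP s.
  have r1 : Num.sqrt (val s * (1 - val s)) <= 1.
    by rewrite -[leRHS]sqrtr1 ler_wsqrtr //; nra.
  have r0 := sqrtr_ge0 (val s * (1 - val s)).
  have bound (x : R) : 0 <= x -> x <= 1 -> `|2 / k.+1%:R * x| < e.
    move=> x0 x1; rewrite ger0_norm ?mulr_ge0 ?divr_ge0 //.
    apply: (@le_lt_trans _ _ (2 / k.+1%:R * 1)); last by rewrite mulr1 mulrC -ltr_pdivlMr.
    by rewrite ler_wpM2l // divr_ge0.
  split; rewrite [X in `|X - _|]/= sub0r normrN; first exact: bound.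
  by rewrite normrMsign; exact: bound.
rewrite /circle_loop concatE; case: ifP => _; first exact: arc_small.
exact: arc_small.
Qed.

(** Up to homotopy the constant loop drops out and leaves a power of
    [x_1 x_1^-1]. *)
Lemma large_oscillation_nullhomotopic n : path_homotopic (large_oscillation base_loop n) base_loop.
Proof.
have pw f m : path_homotopic f base_loop -> path_homotopic (power f m) base_loop.
  move=> fb; elim: m => [|m IH]; first exact: path_homotopic_refl.
  apply: path_homotopic_trans (concat_homotopic fb IH) _; exact: concat_cst_l.
apply: pw; apply: path_homotopic_trans (concat_reverse_r (circle_loop 0)).
by apply: concat_homotopic; exact: concat_cst_r.
Qed.

Definition oscillating_classes : set (pi1 R (HE_base R)) := [set a | oscillating (repr a)].

Lemma mem_oscillating_classes f : oscillating_classes (q f) <-> oscillating f.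
Proof.
by split; apply: oscillating_homotopic; [|apply: path_homotopic_sym]; exact: repr_homotopic.
Qed.

Lemma closed_oscillating_classes : closed oscillating_classes.
Proof.
apply/pi1_closedP.
rewrite -openC openE => f Af.
apply/nbhs_loop.
have nf : ~ oscillating f by move=> o; exact: (Af (iffRL (mem_oscillating_classes f) o)).
apply: loop_nearS (near_not_oscillating nf) => g ng Ag.
exact: (ng (iffLR (mem_oscillating_classes g) Ag)).
Qed.

Definition oscillating_products : set (pi1 R (HE_base R) * pi1 R (HE_base R)) :=
  [set ab | oscillating_classes (pi1_mul ab.1 ab.2)].

Lemma mem_oscillating_products f g : oscillating_products (q f, q g) <-> oscillating (concat f g).
Proof. by rewrite -mem_oscillating_classes -pi1_mulE. Qed.

(** The order of choices matters: first [n], so large that all circles from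
    [X_{n+1}] on are small for the neighbourhood of [1] in the first factor;
    then [k], so large that [w(n, k)] is close to its null-homotopic limit for
    the neighbourhood in the second factor. *)
Lemma not_closed_oscillating_products : ~ closed oscillating_products.
Proof.
rewrite -openC => oB.
have one_notin : (~` oscillating_products) (q base_loop, q base_loop).
  move=> /mem_oscillating_products.
  move=> /(oscillating_homotopic (concat_cst_l _)); exact: not_oscillating_base.
have : nbhs (q base_loop, q base_loop) (~` oscillating_products) by exact: open_nbhs_nbhs.
move=> [[U V] /= [HU HV] UV].
have pre f (W : set (pi1 R (HE_base R))) : nbhs (q f) W -> loop_near f (fun g => W (q g)).
  move=> Wf; apply/nbhs_loop.
  have cq : continuous (q : L -> pi1 R (HE_base R)) by move=> h; exact: pi_continuous.
  exact: cq Wf.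
have [d d0 Ud] := pre base_loop U HU.
have [N HN] := circle_loop_small d0.
pose n := N.+1.
have [|e e0 Ve] := pre (large_oscillation base_loop n) V.
  rewrite (_ : q _ = q base_loop) //; apply/loop_class_eq.
  exact: large_oscillation_nullhomotopic.
have [M HM] := circle_loop_small e0.
pose k := (n + M).+1.
have nk : (n < k)%N by rewrite /k; lia.
apply: (UV (q (small_oscillation n k), q (large_oscillation (circle_loop k) n))).
  split=> /=.
    apply: Ud; apply: base_close_power => //.
    by apply: base_close_concat; apply: HN; rewrite /k /n; lia.
  apply: Ve; apply: power_close => //.
  have ck : loop_close e base_loop (circle_loop k) by apply: HM; rewrite /k; lia.
  by apply: concat_close; apply: concat_close => // t; exact: close_refl.
by apply/mem_oscillating_products; exact: oscillating_witness.
Qed.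

Lemma closed_preimage_oscillating_products :
  closed ((fun fg : L * L => (q fg.1, q fg.2)) @^-1` oscillating_products).
Proof.
rewrite -openC openE => -[f g] fg.
have nfg : ~ oscillating (concat (f : loop) (g : loop)).
  by move=> o; apply: fg; apply/mem_oscillating_products.
have [e e0 He] := near_not_oscillating nfg.
have nbhs_near (h : loop) : nbhs (h : L) [set h' | loop_close e h h'].
  by apply/nbhs_loop; exists e.
exists ([set f' | loop_close e f f'], [set g' | loop_close e g g']) => /=.
  by split; exact: nbhs_near.
move=> [f' g'] [ff gg] /mem_oscillating_products.
by apply: He; exact: concat_close.
Qed.

End oscillation.

Theorem theorem1 (R : realType) :
  let L := loop_space R (HE_base R) in
  let pi1HE := pi1 R (HE_base R) in
  let q : L -> pi1HE := @loop_class R (HE R) (HE_base R) in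
  [/\ ~ quotient_map (fun fg : L * L => (q fg.1, q fg.2)),
      ~ continuous (fun ab : pi1HE * pi1HE => pi1_mul ab.1 ab.2)
    & ~ is_topological_group pi1HE].
Proof.
move=> L pi1HE q.
have ncM : ~ continuous (fun ab : pi1HE * pi1HE => pi1_mul ab.1 ab.2).
  move=> cM; apply: (@not_closed_oscillating_products R).
  by apply: closed_comp (@closed_oscillating_classes R) => ab _; exact: cM.
split=> //.
  move=> [_ /(_ (@oscillating_products R))[_ cl]]; apply: (@not_closed_oscillating_products R).
  by apply: cl; exact: closed_preimage_oscillating_products.
by move=> [cM _]; exact: ncM cM.
Qed.
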